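(* Let $\langle \ell, p\rangle$ be a problem with agent set $N=\{1,\dots,n\}$. For every solution $\phi$, the game induced by $\phi$ is supermodular, is dominance-solvable, and has a unique Nash equilibrium.
   Context: Agents: $N=\{1,\dots,n\}$, ordered. A problem $\langle \ell,p\rangle$ consists of losses $\ell=(\ell_1,\dots,\ell_n)\in\mathbb{R}^n_{>0}$ and technologies $p=(p_i)_{i\in N}$, where each $p_i:\mathbb{R}_{\ge 0}\to[0,1]$ is strictly increasing, strictly concave, continuous on $[0,\infty)$ and differentiable on $(0,\infty)$, with $p_i(0)=0$ and $p_i'(x_i)\to\infty$ as $x_i\to 0$. A profile is $x=(x_i)_{i\in N}\in X=\mathbb{R}^n_{\ge 0}$. A solution is a function $\phi:N\times N\to\mathbb{R}_{\ge 0}$ with $\phi(i,j)=0$ for all $j<i$ and (balance) $\sum_{j\ge i}\phi(i,j)=\sum_{j\ge i}\ell_j$ for all $i\in N$. Given $\phi$, the expected cost of agent $k$ at profile $x$ is \[ C_k(x;\phi)=\sum_{j<k}\Big(\prod_{i<j}p_i(x_i)\Big)(1-p_j(x_j))\,\phi(j,k)+\Big(\prod_{i<k}p_i(x_i)\Big)(1-p_k(x_k))\,\phi(k,k)+x_k \] (empty sums are $0$, empty products are $1$). The solution $\phi$ induces the simultaneous-move game in which each agent $k$ chooses a (pure) strategy $x_k\in\mathbb{R}_{\ge 0}$ to minimize $C_k(\cdot;\phi)$ (i.e. has payoff $-C_k$). Supermodular means that each payoff $-C_k$ has increasing differences in $(x_k,x_{-k})$: for $x_k'\ge x_k$ and $x_{-k}'\ge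 x_{-k}$ (componentwise), $C_k(x_k',x_{-k}';\phi)-C_k(x_k,x_{-k}';\phi)\le C_k(x_k',x_{-k};\phi)-C_k(x_k,x_{-k};\phi)$ (for smooth costs, $\partial^2 C_k/\partial x_i\partial x_k\le 0$ for $i\ne k$). Dominance-solvable means that iterated elimination of strictly dominated pure strategies leaves exactly one strategy profile. Nash equilibrium refers to pure strategies. *)

(* Defs.v *)
From HB Require Import structures.
From mathcomp Require Import all_boot all_order all_algebra.
From mathcomp Require Import all_classical all_reals all_analysis.
Set Implicit Arguments.
Unset Strict Implicit.
Unset Printing Implicit Defensive.
Import Order.TTheory GRing.Theory Num.Theory.
Import numFieldNormedType.Exports.
Local Open Scope classical_set_scope.
Local Open Scope ring_scope.

(** * Games with nonnegative real strategies

   Agents are the elements of ['I_n]; agent [k]'s strategy set is [0, +oo) and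
   [u k x] is agent [k]'s payoff at the profile [x]. A payoff [u k] is a total
   function on ['I_n -> R], but only its values on [profiles] matter below. *)

Definition profiles (R : realType) (n : nat) : set ('I_n -> R) :=
  [set x | forall i, 0 <= x i].

(* [deviate x k a] is (a, x_{-k}); it does not depend on [x k]. *)
Definition deviate (R : realType) (n : nat) (x : 'I_n -> R) (k : 'I_n) (a : R)
  : 'I_n -> R := fun i => if i == k then a else x i.

Definition nash_equilibrium (R : realType) (n : nat)
    (u : 'I_n -> ('I_n -> R) -> R) (x : 'I_n -> R) : Prop :=
  profiles x /\ forall (k : 'I_n) (a : R), 0 <= a -> u k (deviate x k a) <= u k x.

Definition supermodular (R : realType) (n : nat)
    (u : 'I_n -> ('I_n -> R) -> R) : Prop :=
  forall (k : 'I_n) (a a' : R) (x x' : 'I_n -> R),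
    0 <= a -> a <= a' ->
    profiles x -> (forall i, i != k -> x i <= x' i) -> profiles x' ->
    u k (deviate x k a') - u k (deviate x k a)
      <= u k (deviate x' k a') - u k (deviate x' k a).

(* [b] strictly dominates [a] for agent [k] when every opponent [i != k] is
   restricted to the strategies in [D i]. *)
Definition strictly_dominates (R : realType) (n : nat)
    (u : 'I_n -> ('I_n -> R) -> R) (D : 'I_n -> set R) (k : 'I_n) (b a : R)
  : Prop :=
  forall x : 'I_n -> R, (forall i, i != k -> D i (x i)) ->
    u k (deviate x k a) < u k (deviate x k b).

(* Each round removes, simultaneously for all agents, every strategy that is
   strictly dominated, within the current restricted game, by a remaining pure
   strategy. *)
Fixpoint undominated (R : realType) (n : nat)
    (u : 'I_n -> ('I_n -> R) -> R) (t : nat) : 'I_n -> set R :=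
  match t with
  | 0%N => fun _ => [set a | 0 <= a]
  | s.+1 => fun k =>
      [set a | undominated u s k a /\
        ~ exists b, undominated u s k b /\
            strictly_dominates u (undominated u s) k b a]
  end.

Definition dominance_solvable (R : realType) (n : nat)
    (u : 'I_n -> ('I_n -> R) -> R) : Prop :=
  exists! x : 'I_n -> R, forall (t : nat) (k : 'I_n), undominated u t k (x k).

(** * Problems, solutions and the induced game *)

(* A technology is a function on [0, +oo); its values at negative reals are
   irrelevant. *)
Record is_technology (R : realType) (f : R -> R) : Prop := {
  technology_range : forall x : R, 0 <= x -> 0 <= f x <= 1 ;
  technology_increasing : forall x y : R, 0 <= x -> x < y -> f x < f y ;
  technology_concave : forall x y t : R, 0 <= x -> 0 <= y -> x != y -> 0 < t < 1 ->
    t * f x + (1 - t) * f y < f (t * x + (1 - t) * y) ;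
  technology_continuous : {within `[0, +oo[, continuous f} ;
  technology_derivable : forall x : R, 0 < x -> derivable f x 1 ;
  technology_0 : f 0 = 0 ;
  technology_inada : derive1 f x @[x --> 0^'+] --> +oo
}.

Record is_problem (R : realType) (n : nat)
    (l : 'I_n -> R) (p : 'I_n -> R -> R) : Prop := {
  loss_gt0 : forall i, 0 < l i ;
  problem_technology : forall i, is_technology (p i)
}.

Record is_solution (R : realType) (n : nat)
    (l : 'I_n -> R) (phi : 'I_n -> 'I_n -> R) : Prop := {
  solution_ge0 : forall i j, 0 <= phi i j ;
  solution_upper : forall i j : 'I_n, (j < i)%N -> phi i j = 0 ;
  solution_balance : forall i : 'I_n,
    \sum_(j < n | (i <= j)%N) phi i j = \sum_(j < n | (i <= j)%N) l j
}.

Definition expected_cost (R : realType) (n : nat) (p : 'I_n -> R -> R)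
    (phi : 'I_n -> 'I_n -> R) (k : 'I_n) (x : 'I_n -> R) : R :=
  \sum_(j < n | (j < k)%N)
     (\prod_(i < n | (i < j)%N) p i (x i)) * (1 - p j (x j)) * phi j k
  + (\prod_(i < n | (i < k)%N) p i (x i)) * (1 - p k (x k)) * phi k k
  + x k.

Definition induced_game (R : realType) (n : nat) (p : 'I_n -> R -> R)
    (phi : 'I_n -> 'I_n -> R) : 'I_n -> ('I_n -> R) -> R :=
  fun k x => - expected_cost p phi k x.

(* Main.v *)
(** An agent's own strategy [x_k] enters [C_k] only through
   [c * (1 - p_k x_k) + x_k], where [c = (\prod_(i < k) p_i x_i) * phi k k]
   depends on the agents before [k] alone and is nondecreasing in their
   strategies; this gives supermodularity. Since [p_k] is strictly concave, this
   function of [x_k] has exactly one minimizer on [0, +oo). Hence a profile of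
   iterated best replies can be built agent by agent, and after [t] rounds of
   elimination it is all that is left to the first [t] agents. *)
Require Import Defs.
From mathcomp Require Import all_boot all_order all_algebra.
From mathcomp Require Import all_classical all_reals all_analysis.
From mathcomp Require Import ring lra.

Set Implicit Arguments.
Unset Strict Implicit.
Unset Printing Implicit Defensive.
Import Order.TTheory GRing.Theory Num.Theory.
Import numFieldNormedType.Exports.
Local Open Scope classical_set_scope.
Local Open Scope ring_scope.

(** Strictness is what lets one notion serve both purposes: ruling out other equilibria and
    eliminating strategies by strict dominance. The value [x k] is immaterial, since [deviate]
    overwrites it. *)
Definition strict_best_reply (R : realType) (n : nat)
    (u : 'I_n -> ('I_n -> R) -> R) (k : 'I_n) (x : 'I_n -> R) (b : R) : Prop :=
  0 <= b /\
  forall a, 0 <= a -> a != b -> u k (deviate x k a) < u k (deviate x k b).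

Lemma deviate_id (R : realType) (n : nat) (x : 'I_n -> R) (k : 'I_n) :
  deviate x k (x k) = x.
Proof. by apply/funext => i; rewrite /deviate; case: eqP => [->|]. Qed.

Lemma undominated_ge0 (R : realType) (n : nat) (u : 'I_n -> ('I_n -> R) -> R)
    (t : nat) (k : 'I_n) (a : R) : undominated u t k a -> 0 <= a.
Proof. by elim: t k a => [|t IH] k a //= [/IH]. Qed.

(** By induction on the rounds, [x] itself lies in the restricted game, so a strategy dominating
    [x k] would be a profitable deviation at [x]. *)
Lemma nash_undominated (R : realType) (n : nat) (u : 'I_n -> ('I_n -> R) -> R)
    (x : 'I_n -> R) (t : nat) (k : 'I_n) :
  nash_equilibrium u x -> undominated u t k (x k).
Proof.
move=> [x0 xN]; elim: t k => [|t IH] k; first exact: x0.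
split=> // -[b [bt dom]].
have := dom x (fun i _ => IH i).
by rewrite deviate_id ltNge xN // (undominated_ge0 bt).
Qed.

Section StrictBestReplies.
Variables (R : realType) (n : nat) (u : 'I_n -> ('I_n -> R) -> R).
(** The order of the agents enters only here: strict best replies look back to earlier agents, which
    permits induction along ['I_n]. *)
Hypothesis u_recursive : forall (k : 'I_n) (x y : 'I_n -> R) (b : R),
  (forall i : 'I_n, (i < k)%N -> x i = y i) ->
  strict_best_reply u k x b -> strict_best_reply u k y b.

Lemma strict_nash (x : 'I_n -> R) :
  (forall k, strict_best_reply u k x (x k)) -> nash_equilibrium u x.
Proof.
move=> xb; split=> [k|k a a0]; first by case: (xb k).
have [->|ax] := eqVneq a (x k); first by rewrite deviate_id.
by case: (xb k) => _ /(_ a a0 ax); rewrite deviate_id => /ltW.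
Qed.

Lemma exists_strict_nash :
  (forall k x, profiles x -> exists b, strict_best_reply u k x b) ->
  exists x, forall k, strict_best_reply u k x (x k).
Proof.
move=> ex.
suff H m : exists2 x, profiles x &
    forall k : 'I_n, (k < m)%N -> strict_best_reply u k x (x k).
  by have [x _ xb] := H n; exists x => k; exact: xb.
elim: m => [|m [x x0 xb]]; first by exists (fun=> 0) => // i; rewrite lexx.
(* If [n <= m] there is no agent [m] to treat; otherwise its strategy is overwritten by its best
   reply [b]. *)
have [nm|mn] := leqP n m.
  by exists x => // k _; apply: xb; exact: leq_trans nm.
pose k0 := Ordinal mn; have [b bx] := ex k0 x x0.
exists (deviate x k0 b) => [i|k].
  by rewrite /deviate; case: eqP => _; [case: bx | exact: x0].
(* Overwriting agent [m] changes nothing before any agent up to [m], so the best replies already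
   found persist. *)
have agree (k' : 'I_n) : (k' <= m)%N ->
    forall i : 'I_n, (i < k')%N -> x i = deviate x k0 b i.
  move=> km i ik; rewrite /deviate; case: eqP => // ik0.
  by move: (leq_trans ik km); rewrite ik0 ltnn.
rewrite ltnS => km; apply: u_recursive (agree k km) _.
rewrite /deviate; case: eqP => [->//|kk0]; apply: xb.
by rewrite ltn_neqAle km andbT; apply/eqP => e; apply: kk0; exact: val_inj.
Qed.

Variable x : 'I_n -> R.
Hypothesis x_best : forall k, strict_best_reply u k x (x k).

(** Strong induction on the agent: once [y] agrees with [x] before [k], the strategy [x k] is a
    strict best reply to [y] too, and any other [y k] would be improvable. *)
Lemma strict_nash_unique (y : 'I_n -> R) : nash_equilibrium u y -> x = y.
Proof.
move=> [y0 yN]; apply/funext => k; have [m] := ubnP (k : nat).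
elim: m k => // m IH k; rewrite ltnS => km.
have [] : strict_best_reply u k y (x k).
  by apply: u_recursive (x_best k) => i ik; apply: IH; exact: leq_trans km.
move=> xk0 /(_ (y k) (y0 k)); have [->//|yx] := eqVneq (y k) (x k).
by move=> /(_ isT); rewrite deviate_id ltNge yN.
Qed.

(** When agent [k] is treated, the agents before it are already pinned to [x]. Hence [x k] strictly
    beats every other survivor against all surviving opponents, and it survives itself because [x]
    is an equilibrium. *)
Lemma undominated_strict_nash (t : nat) (k : 'I_n) (a : R) :
  (k < t)%N -> undominated u t k a -> x k = a.
Proof.
elim: t k a => // t IH k a; rewrite ltnS => kt [at_ ndom].
apply/eqP/negPn/negP => xa; apply: ndom; exists (x k); split.
  exact/nash_undominated/strict_nash.
move=> y yt; have [] : strict_best_reply u k y (x k).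
  apply: u_recursive (x_best k) => i ik; apply: IH; first exact: leq_trans kt.
  by apply: yt; rewrite neq_ltn ik.
by move=> _; apply; [exact: undominated_ge0 at_ | rewrite eq_sym].
Qed.

Lemma strict_nash_dominance_solvable : dominance_solvable u.
Proof.
exists x; split=> [t k|y yu]; first exact/nash_undominated/strict_nash.
by apply/funext => k; exact: undominated_strict_nash (ltnSn k) (yu _ k).
Qed.

End StrictBestReplies.

Lemma technology_le (R : realType) (f : R -> R) (a b : R) :
  is_technology f -> 0 <= a -> a <= b -> f a <= f b.
Proof.
move=> tf a0; rewrite le_eqVlt => /predU1P[->//|ab].
exact/ltW/(technology_increasing tf).
Qed.

(** Existence comes from compactness of [[0, c]], uniqueness from strict concavity of [f]. *)
Lemma technology_cost_minimizer (R : realType) (f : R -> R) (c : R) :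
  is_technology f -> 0 <= c ->
  exists2 b, 0 <= b &
    forall a, 0 <= a -> a != b -> c * (1 - f b) + b < c * (1 - f a) + a.
Proof.
move=> tf c0; pose g a := c * (1 - f a) + a.
have g_cont : {within `[0, c], continuous g}.
  have fc : {within `[0, c], continuous f}.
    apply: continuous_subspaceW (technology_continuous tf) => z /=.
    by rewrite !in_itv /= => /andP[->].
  move=> z; apply: cvgD; last exact: (continuous_subspaceT (fun _ => cvg_id)).
  by apply: cvgM; [exact: cvg_cst | apply: cvgB; [exact: cvg_cst | exact: fc]].
have [b /itvP b_itv b_min] := EVT_min c0 g_cont.
have b0 : 0 <= b by rewrite b_itv.
(* Beyond [c] the cost exceeds its value [c] at [0]. *)
have gb_le a : 0 <= a -> g b <= g a.
  move=> a0; have [ac|ca] := leP a c; first by apply: b_min; rewrite in_itv /= a0.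
  apply: (@le_trans _ _ (g 0)); first by apply: b_min; rewrite in_itv /= lexx.
  rewrite /g (technology_0 tf).
  have /andP[_ fa1] := technology_range tf a0.
  have : 0 <= c * (1 - f a) by rewrite mulr_ge0 ?subr_ge0.
  by lra.
exists b => // a a0 ab; rewrite lt_neqAle; apply/andP; split; last exact: gb_le.
apply/eqP => gab.
(* If [a] and [b] both attained the minimum, their midpoint [m] would cost strictly less when
   [c > 0]. *)
have h01 : 0 < (2^-1 : R) < 1 by lra.
have := technology_concave tf a0 b0 ab h01.
set m := 2^-1 * a + _ => fm.
have m0 : 0 <= m by rewrite /m; lra.
have := gb_le m m0; rewrite /g.
(* For [c = 0] concavity is of no help, but the cost is then the identity, so equal costs give
   [a = b]. *)
move: c0; rewrite le_eqVlt => /predU1P[c0|c0].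
  by move: gab ab; rewrite -c0 !mul0r !add0r => -> /eqP.
move: fm; rewrite -(ltr_pM2l c0) => fm le_bm.
by move: fm le_bm gab; rewrite /m; nra.
Qed.

Definition reach (R : realType) (n : nat) (p : 'I_n -> R -> R) (k : 'I_n)
    (x : 'I_n -> R) : R := \prod_(i < n | (i < k)%N) p i (x i).

Lemma reach_ge0 (R : realType) (n : nat) (p : 'I_n -> R -> R) (k : 'I_n)
    (x : 'I_n -> R) :
  (forall i, is_technology (p i)) -> profiles x -> 0 <= reach p k x.
Proof.
by move=> tp x0; apply: prodr_ge0 => i _; case/andP: (technology_range (tp i) (x0 i)).
Qed.

Lemma reach_le (R : realType) (n : nat) (p : 'I_n -> R -> R) (k : 'I_n)
    (x y : 'I_n -> R) :
  (forall i, is_technology (p i)) -> profiles x ->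
  (forall i, i != k -> x i <= y i) -> reach p k x <= reach p k y.
Proof.
move=> tp x0 xy; apply: ler_prod => i ik.
case/andP: (technology_range (tp i) (x0 i)) => -> _ /=.
by apply: technology_le (tp i) (x0 i) _; apply: xy; rewrite neq_ltn ik.
Qed.

(** The remainder [r] collects the terms of earlier agents. It is chosen before [a], so it cancels
    whenever two strategies of agent [k] are compared. *)
Lemma expected_cost_deviate (R : realType) (n : nat) (p : 'I_n -> R -> R)
    (phi : 'I_n -> 'I_n -> R) (k : 'I_n) (x : 'I_n -> R) :
  exists r, forall a, expected_cost p phi k (deviate x k a) =
    r + (reach p k x * phi k k * (1 - p k a) + a).
Proof.
have reach_deviate (j : 'I_n) a : (j <= k)%N -> reach p j (deviate x k a) = reach p j x.
  move=> jk; apply: eq_bigr => i ij; rewrite /deviate; case: eqP => // ik.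
  by move: (leq_trans ij jk); rewrite ik ltnn.
exists (\sum_(j < n | (j < k)%N) reach p j x * (1 - p j (x j)) * phi j k) => a.
rewrite /expected_cost -/(reach p k (deviate x k a)) reach_deviate //.
rewrite [deviate x k a k]/deviate eqxx -addrA; congr (_ + (_ + _)); last by ring.
apply: eq_bigr => j jk; rewrite -/(reach p j (deviate x k a)) reach_deviate 1?ltnW //.
by rewrite /deviate; case: eqP => // jk'; move: jk; rewrite jk' ltnn.
Qed.

Lemma strict_best_replyE (R : realType) (n : nat) (p : 'I_n -> R -> R)
    (phi : 'I_n -> 'I_n -> R) (k : 'I_n) (x : 'I_n -> R) (b : R) :
  let c := reach p k x * phi k k in
  strict_best_reply (induced_game p phi) k x b <->
  0 <= b /\
  forall a, 0 <= a -> a != b -> c * (1 - p k b) + b < c * (1 - p k a) + a.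
Proof.
have [r rE] := expected_cost_deviate p phi k x.
split=> -[b0 H]; split=> // a a0 ab; have := H a a0 ab;
  by rewrite /induced_game !rE ltrN2 ltrD2l.
Qed.

Lemma induced_game_recursive (R : realType) (n : nat) (p : 'I_n -> R -> R)
    (phi : 'I_n -> 'I_n -> R) (k : 'I_n) (x y : 'I_n -> R) (b : R) :
  (forall i : 'I_n, (i < k)%N -> x i = y i) ->
  strict_best_reply (induced_game p phi) k x b ->
  strict_best_reply (induced_game p phi) k y b.
Proof.
move=> xy; rewrite !strict_best_replyE.
suff -> : reach p k x = reach p k y by [].
by apply: eq_bigr => i ik; rewrite xy.
Qed.

Lemma induced_game_supermodular (R : realType) (n : nat) (p : 'I_n -> R -> R)
    (phi : 'I_n -> 'I_n -> R) :
  (forall i, is_technology (p i)) -> (forall i j, 0 <= phi i j) ->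
  supermodular (induced_game p phi).
Proof.
move=> tp phi0 k a a' x x' a0 aa' x0 xx' _.
have [r rE] := expected_cost_deviate p phi k x.
have [r' r'E] := expected_cost_deviate p phi k x'.
rewrite /induced_game !rE !r'E.
(* This product is exactly the gap between the two payoff increments. *)
have : 0 <= (reach p k x' - reach p k x) * phi k k * (p k a' - p k a).
  by rewrite !mulr_ge0 // subr_ge0 ?reach_le ?technology_le.
by lra.
Qed.

Theorem proposition2 (R : realType) (n : nat) (l : 'I_n -> R)
    (p : 'I_n -> R -> R) (phi : 'I_n -> 'I_n -> R) :
  is_problem l p -> is_solution l phi ->
  [/\ supermodular (induced_game p phi),
      dominance_solvable (induced_game p phi) &
      exists! x : 'I_n -> R, nash_equilibrium (induced_game p phi) x].
Proof.
move=> [_ tp] [phi0 _ _].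
have rec := @induced_game_recursive R n p phi.
have [k x x0|x xb] := exists_strict_nash rec.
  have c0 : 0 <= reach p k x * phi k k by rewrite mulr_ge0 ?reach_ge0.
  have [b b0 bmin] := technology_cost_minimizer (tp k) c0.
  by exists b; apply/strict_best_replyE.
split; first exact: induced_game_supermodular.
  exact (strict_nash_dominance_solvable rec xb).
exists x; split; first exact: strict_nash.
exact (strict_nash_unique rec xb).
Qed.
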